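(* Let $(\alpha,\beta)$ be a pair of real-valued random variables such that $\mathbb{P}(\alpha\neq 0)=1$, $\mathbb{P}(|\alpha|\ne 1)>0$ and $\mathbb{E}\{\ln|\alpha|\}\le 0$. Let $y:\mathbb{R}\to\mathbb{R}$ be a bounded function which is uniformly continuous on $\mathbb{R}$ and satisfies $$y(x)=\mathbb{E}\{y(\alpha(x-\beta))\}\qquad\text{for all } x\in\mathbb{R}.$$ Then $y$ is constant.
   Context: $\mathbb{E}$ denotes expectation with respect to the joint distribution of $(\alpha,\beta)$, which is an arbitrary probability measure on $\mathbb{R}^2$ subject to the stated hypotheses; no moment or independence assumption is made on $\beta$. The condition $\mathbb{E}\{\ln|\alpha|\}\le 0$ means that this expectation is well defined (the value $-\infty$ being allowed) and is at most $0$. *)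

(* Defs.v *)
From HB Require Import structures.
From mathcomp Require Import all_boot all_order all_algebra.
From mathcomp Require Import all_classical all_reals all_analysis.
Import Order.TTheory GRing.Theory Num.Theory.
Import numFieldNormedType.Exports.

Set Implicit Arguments.
Unset Strict Implicit.
Unset Printing Implicit Defensive.

Local Open Scope classical_set_scope.
Local Open Scope ring_scope.

(* The Lebesgue integral of the library is total: it is the integral of the
   positive part minus that of the negative part, also when both are +oo.
   The predicate below excludes that case; 'E_P[X] may still be infinite. *)
Definition expectation_defined d (T : measurableType d) (R : realType)
    (P : probability T R) (X : T -> R) : Prop :=
  (\int[P]_w (EFin \o X)^\+ w < +oo)%E \/
  (\int[P]_w (EFin \o X)^\- w < +oo)%E.

(* Main.v *)
(* Let Omega be the modulus of continuity of y, xi = ln |alpha| and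
   psi u = Omega (exp u). Then psi is bounded, nondecreasing, tends to 0 at -oo,
   and psi u <= E psi (u + xi). Put f = psi^2 and L = sup f. Since
   E f (u + xi) - f u >= E (psi (u + xi) - psi u)^2, while the integral over u of
   f (u + xi) - f u is L xi, integrating over u and using E xi <= 0 forces
   psi (u + xi) = psi u; as xi <= -a with positive probability for some a > 0,
   psi is then a-periodic, hence 0, and y is constant.
   The integral over u is replaced by sums over grids of vanishing mesh, and xi
   by max (xi, -K), which is legitimate because psi is nondecreasing and which
   covers the case E xi = -oo. *)
Require Import Defs.
From HB Require Import structures.
From mathcomp Require Import all_boot all_order all_algebra.
From mathcomp Require Import all_classical all_reals all_analysis.
From mathcomp Require Import measurable_realfun ring lra.
Import Order.TTheory GRing.Theory Num.Theory.
Import numFieldNormedType.Exports.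

Local Open Scope classical_set_scope.
Local Open Scope ring_scope.

Set Implicit Arguments.
Unset Strict Implicit.

(** * Sums over a grid, replacing the integral over [u] *)

Lemma sum_grid_step (R : realType) (f : R -> R) (x d : R) (n : nat) :
  \sum_(k < n) f (x + k%:R * d + d) - \sum_(k < n) f (x + k%:R * d) =
  f (x + n%:R * d) - f x.
Proof.
elim: n => [|n IHn]; first by rewrite !big_ord0 mul0r addr0 !subrr.
rewrite !big_ord_recr /= opprD addrACA IHn -(natr1 n) mulrDl mul1r !addrA.
ring.
Qed.

(** Discrete form of: the integral over [u] of [f (u + t) - f u] is [L * t]. A shift by one mesh [d]
    telescopes to a right end value minus a left end value. This is at most [L] for a step to the
    right, and at least [L - 2 * eta] for a step undone to the left within distance [K]. Rounding
    the shift to a multiple of [d] costs at most one step, hence the [+ 1]. *)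
Lemma sum_grid_shift_le (R : realType) (f : R -> R) (L eta d K x : R) (n : nat)
    (f_nd : {homo f : s t / s <= t}) (f_ge0 : forall t, 0 <= f t)
    (f_le : forall t, f t <= L) (d_gt0 : 0 < d) (K_ge0 : 0 <= K)
    (eta_ge0 : 0 <= eta) (f_left : f x <= eta)
    (f_right : L - eta <= f (x + n%:R * d - K)) (t : R) :
  \sum_(k < n) f (x + k%:R * d + t) - \sum_(k < n) f (x + k%:R * d) <=
  L * (Num.max t (- K) / d + 1) + 2 * eta * K / d.
Proof.
pose F s := \sum_(k < n) f (x + k%:R * d + s).
have F_nd s1 s2 : s1 <= s2 -> F s1 <= F s2.
  by move=> s12; apply: ler_sum => k _; apply: f_nd; rewrite lerD2l.
have F_step s : F (s + d) - F s = f (x + s + n%:R * d) - f (x + s).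
  rewrite -sum_grid_step /F; congr (_ - _); apply: eq_bigr => k _; congr f; ring.
have F0 : \sum_(k < n) f (x + k%:R * d) = F 0.
  by apply: eq_bigr => k _; rewrite addr0.
have L_ge0 : 0 <= L := le_trans (f_ge0 0) (f_le 0).
have F_up m : F (m%:R * d) - F 0 <= m%:R * L.
  elim: m => [|m IHm]; first by rewrite !mul0r subrr.
  rewrite -natr1 !mulrDl !mul1r.
  have := F_step (m%:R * d).
  have := f_le (x + m%:R * d + n%:R * d); have := f_ge0 (x + m%:R * d); lra.
(* The bound [m%:R * d <= K] keeps the shifted right end beyond [x + n%:R * d - K], where [f] is
   still at least [L - eta]. *)
have F_down m : m%:R * d <= K ->
    F (- (m%:R * d)) - F 0 <= - (m%:R * (L - 2 * eta)).
  elim: m => [|m IHm]; first by rewrite !mul0r oppr0 subrr.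
  rewrite -natr1 !mulrDl !mul1r => mK.
  have /IHm : m%:R * d <= K by lra.
  have := F_step (- (m%:R * d + d)); rewrite opprD addrNK => step IH.
  have := f_nd (x + n%:R * d - K) (x + (- (m%:R * d) - d) + n%:R * d).
  have := f_nd (x + (- (m%:R * d) - d)) x.
  have md0 : 0 <= m%:R * d by rewrite mulr_ge0 // ltW.
  have h1 : x + (- (m%:R * d) - d) <= x by lra.
  have h2 : x + n%:R * d - K <= x + (- (m%:R * d) - d) + n%:R * d by lra.
  move=> /(_ h1) ? /(_ h2) ?; lra.
rewrite F0 -/(F t); set s := Num.max t (- K).
have Kd_ge0 : 0 <= eta * (K / d) by rewrite mulr_ge0 // divr_ge0 // ltW.
rewrite -!mulrA.
have Fts : F t <= F s by apply: F_nd; rewrite le_max lexx.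
have Ks : - K <= s by rewrite le_max lexx orbT.
have [s0|s0] := leP 0 s.
  have sd : 0 <= s / d by rewrite divr_ge0 // ltW.
  have /andP[m1 m2] := truncn_itv sd.
  set m := Num.truncn (s / d) in m1 m2.
  have Fs : F s <= F (m.+1%:R * d).
    by apply: F_nd; rewrite -ler_pdivrMr // ltW.
  have := F_up m.+1; rewrite -natr1 in Fs m2 *.
  have : (m%:R + 1) * L <= (s / d + 1) * L by rewrite ler_wpM2r // lerD2r.
  lra.
(* For negative [s] the number of steps is rounded down: this gives [s <= - (m%:R * d)], and
   monotonicity of [F] applies. *)
have sd : 0 <= - s / d by rewrite divr_ge0 ?oppr_ge0 // ltW.
have /andP[m1 m2] := truncn_itv sd.
set m := Num.truncn (- s / d) in m1 m2.
rewrite ler_pdivlMr // in m1.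
have Fs : F s <= F (- (m%:R * d)) by apply: F_nd; lra.
have mK : m%:R * d <= K by lra.
have := F_down m mK.
rewrite -natr1 mulNr in m2.
have : (- (s / d) - 1) * L <= m%:R * L by rewrite ler_wpM2r //; lra.
have : m%:R * eta <= (K / d) * eta by rewrite ler_wpM2r // ler_pdivlMr.
lra.
Qed.

(** * Expectations of bounded functions and squares of subharmonic functions *)

Lemma bounded_integrable (R : realType) (d : measure_display)
    (T : measurableType d) (P : probability T R) (g : T -> R) (M : R) :
  measurable_fun setT g -> (forall w, `|g w| <= M) ->
  P.-integrable setT (EFin \o g).
Proof.
move=> mg gM; apply: measurable_bounded_integrable => //.
  by rewrite -ge0_fin_numE ?fin_num_measure.
by exists M; split; [exact: num_real|move=> N MN w _; exact: le_trans (gM w) (ltW MN)].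
Qed.

Lemma Rintegral_sum (R : realType) (d : measure_display)
    (T : measurableType d) (P : probability T R) (n : nat) (g : 'I_n -> T -> R) :
  (forall k, P.-integrable setT (EFin \o g k)) ->
  \int[P]_w (\sum_(k < n) g k w) = \sum_(k < n) \int[P]_w g k w.
Proof.
move=> ig; rewrite /Rintegral; under eq_integral do rewrite -sumEFin.
rewrite integral_sum //; apply/EFin_inj; rewrite -sumEFin fineK.
  by apply: eq_bigr => k _; rewrite fineK //; exact: integrable_fin_num (ig k).
by apply/sum_fin_numP => k _ _; exact: integrable_fin_num (ig k).
Qed.

Lemma Rintegral_probability_cst (R : realType) (d : measure_display)
    (T : measurableType d) (P : probability T R) (r : R) :
  \int[P]_w r = r.
Proof. by rewrite Rintegral_cst //= (@probability_setT _ _ _ P) mulr1. Qed.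

Lemma Rintegral_indic (R : realType) (d : measure_display)
    (T : measurableType d) (P : probability T R) (A : set T) :
  measurable A -> \int[P]_w (\1_A w) = fine (P A).
Proof. by move=> mA; rewrite /Rintegral integral_indic // setIT. Qed.

(* [psi (x + xi) ^ 2 = psi x ^ 2 + 2 psi x D + D ^ 2], where
   [D = psi (x + xi) - psi x] has nonnegative mean. *)
Lemma subharmonic_sqr (R : realType) (d : measure_display)
    (T : measurableType d) (P : probability T R) (xi : T -> R) (psi : R -> R)
    (c a x : R)
    (mxi : measurable_fun setT xi)
    (psi_nd : {homo psi : s t / s <= t}) (psi_ge0 : forall t, 0 <= psi t)
    (psi_le : forall t, psi t <= c) (a_ge0 : 0 <= a)
    (psi_sub : psi x <= \int[P]_w psi (x + xi w)) :
  psi x ^+ 2 + (psi x - psi (x - a)) ^+ 2 * fine (P [set w | xi w <= - a]) <=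
  \int[P]_w (psi (x + xi w) ^+ 2).
Proof.
have mpsi : measurable_fun setT (fun w => psi (x + xi w)).
  apply: measurableT_comp; first exact: nondecreasing_measurable.
  exact: measurable_funD.
have ipsi : P.-integrable setT (EFin \o (fun w => psi (x + xi w))).
  by apply: (@bounded_integrable _ _ _ _ _ c) => // w; rewrite ger0_norm.
have c0 : 0 <= c := le_trans (psi_ge0 0) (psi_le 0).
have ipsi2 : P.-integrable setT (EFin \o (fun w => psi (x + xi w) ^+ 2)).
  apply: (@bounded_integrable _ _ _ _ _ (c ^+ 2)).
    exact: measurable_funX.
  by move=> w; rewrite ger0_norm ?sqr_ge0 // lerXn2r // ?nnegrE.
set A := [set w | xi w <= - a].
have mA : measurable A.
  have := mxi measurableT _ (measurable_itv `]-oo, (- a)]).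
  by rewrite setTI; congr measurable; apply/seteqP; split => w /=; rewrite in_itv.
set q := (psi x - psi (x - a)) ^+ 2.
(* A minorant of [psi (x + xi w) ^+ 2]: the tangent line of the square at [psi x], plus on [A] the
   least value [q] that [D ^ 2] can take there. Its mean needs only the mean of [psi (x + xi w)]. *)
pose h w := - psi x ^+ 2 + 2 * psi x * psi (x + xi w) + q * \1_A w.
have i1 : P.-integrable setT (EFin \o (\1_A : T -> R)).
  exact: integrable_indic.
have i2 : P.-integrable setT (EFin \o (fun w => q * \1_A w)).
  exact: (integrableZl measurableT q i1).
have i3 : P.-integrable setT (EFin \o (fun w => 2 * psi x * psi (x + xi w))).
  exact: (integrableZl measurableT (2 * psi x) ipsi).
have i4 : P.-integrable setT (EFin \o (fun w : T => - psi x ^+ 2)).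
  exact: finite_measure_integrable_cst.
have i5 : P.-integrable setT
    (EFin \o (fun w => - psi x ^+ 2 + 2 * psi x * psi (x + xi w))).
  exact: (integrableD measurableT i4 i3).
have ih : P.-integrable setT (EFin \o h).
  exact: (integrableD measurableT i5 i2).
have Eh : \int[P]_w h w =
    - psi x ^+ 2 + 2 * psi x * \int[P]_w psi (x + xi w) + q * fine (P A).
  rewrite /h RintegralD // RintegralD // !RintegralZl //.
  by rewrite Rintegral_indic // Rintegral_probability_cst.
apply: (@le_trans _ _ (\int[P]_w h w)).
  rewrite Eh; have := ler_wpM2l (psi_ge0 x) psi_sub; nra.
apply: le_Rintegral => // w _; rewrite /h indicE.
have [wA|_] /= := boolP (w \in A); last first.
  have := sqr_ge0 (psi (x + xi w) - psi x); rewrite mulr0; nra.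
move: wA; rewrite inE /A /= => xia.
have h1 : psi (x + xi w) <= psi (x - a) by apply: psi_nd; rewrite lerD2l.
have h2 : psi (x - a) <= psi x by apply: psi_nd; lra.
rewrite mulr1 /q.
have : (psi x - psi (x - a)) ^+ 2 <= (psi x - psi (x + xi w)) ^+ 2.
  by rewrite lerXn2r // ?nnegrE; lra.
nra.
Qed.

(** * Vanishing of bounded monotone subharmonic functions *)

(** By contradiction: if [psi] is not 0, it drops somewhere by some [e > 0], and [M] grid points
    each add at least [p * e ^+ 2] to the mean increment of the grid sum of [f]. The shift estimate
    bounds that increment by [2 * L + 1], whatever the mesh. *)
Lemma monotone_subharmonic_eq0 (R : realType) (d : measure_display)
    (T : measurableType d) (P : probability T R) (xi : T -> R) (psi : R -> R)
    (c a : R) (mxi : measurable_fun setT xi)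
    (psi_nd : {homo psi : s t / s <= t}) (psi_ge0 : forall t, 0 <= psi t)
    (psi_le : forall t, psi t <= c)
    (psi_left : forall e : R, 0 < e -> exists z, psi z <= e)
    (psi_sub : forall x, psi x <= \int[P]_w psi (x + xi w))
    (a_gt0 : 0 < a) (P_gt0 : 0 < fine (P [set w | xi w <= - a]))
    (xi_mean : forall e : R, 0 < e -> exists2 K : R, 0 <= K &
       P.-integrable setT (EFin \o (fun w => Num.max (xi w) (- K))) /\
       \int[P]_w Num.max (xi w) (- K) <= e) (u : R) :
  psi u = 0.
Proof.
apply/eqP; apply: contrapT => /negP psi_u.
have {}psi_u : 0 < psi u by rewrite lt_neqAle eq_sym psi_u psi_ge0.
set p := fine _ in P_gt0.
(* With [a = 2 * b], a drop of [psi] between [v - b] and [v] is also a drop between [x - a] and [x]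
   for every [x] in [[v, v + b]]. *)
have [b b_gt0 aE] : exists2 b : R, 0 < b & a = 2 * b.
  by exists (a / 2); [rewrite divr_gt0|rewrite mulrC divfK].
(* Without such a drop, [psi u] would be at most [psi (u - n%:R * b)] for all [n], against the decay
   of [psi] at -oo. *)
have [v psi_v] : exists v, psi (v - b) < psi v.
  apply: contrapT => nov.
  have psib x : psi x <= psi (x - b).
    by rewrite leNgt; apply/negP => h; apply: nov; exists x.
  have psibn n : psi u <= psi (u - n%:R * b).
    elim: n => [|n IH]; first by rewrite mul0r subr0.
    apply: le_trans IH _; apply: le_trans (psib _) _.
    by rewrite -natr1 mulrDl mul1r opprD addrA.
  have psi_u2 : 0 < psi u / 2 by rewrite divr_gt0.
  have [z hz] := psi_left _ psi_u2.
  have := psibn (Num.truncn (`|u - z| / b)).+1.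
  have := truncnS_gt (`|u - z| / b); rewrite ltr_pdivrMr // => hn.
  have := ler_norm (u - z) => hn2.
  have /psi_nd : u - (Num.truncn (`|u - z| / b)).+1%:R * b <= z by lra.
  lra.
have [e e_gt0 eE] : exists2 e : R, 0 < e & e = psi v - psi (v - b).
  by exists (psi v - psi (v - b)); rewrite ?subr_gt0.
have c_ge0 : 0 <= c := le_trans (psi_ge0 0) (psi_le 0).
pose f x := psi x ^+ 2.
have f_nd : {homo f : s t / s <= t}.
  by move=> s t st; rewrite lerXn2r ?nnegrE // psi_nd.
have f_ge0 t : 0 <= f t by exact: sqr_ge0.
have f_bd t : f t <= c ^+ 2 by rewrite lerXn2r ?nnegrE.
have f_sup : has_sup (range f).
  split; first by exists (f 0), 0.
  by exists (c ^+ 2) => _ [t _ <-].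
pose L := sup (range f).
have f_le t : f t <= L by apply: ub_le_sup; [exact: f_sup.2|exists t].
have L_ge0 : 0 <= L := le_trans (f_ge0 0) (f_le 0).
have pe_gt0 : 0 < p * e ^+ 2 by rewrite mulr_gt0 // exprn_gt0.
(* [M] depends only on [L], [p] and [e]; the mesh [dl = b / M] is fixed afterwards, so that [M] grid
   points fit between [v] and [v + b]. *)
pose M := (Num.truncn ((2 * L + 1) / (p * e ^+ 2))).+1.
have M_gt : 2 * L + 1 < M%:R * (p * e ^+ 2).
  by rewrite -ltr_pdivrMr // truncnS_gt.
have M_gt0 : 0 < M%:R :> R by rewrite ltr0n.
have [dl dl_gt0 Mdl] : exists2 dl : R, 0 < dl & M%:R * dl = b.
  by exists (b / M%:R); [rewrite divr_gt0|rewrite mulrC divfK // gt_eqF].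
(* The tolerance [dl] makes [L / dl] times the truncated mean at most [L]. Since [K] comes after
   [dl], [eta] is chosen last, small enough to absorb [K / dl]. *)
have [K K_ge0 [iK EK]] := xi_mean dl dl_gt0.
have K1_gt0 : 0 < K + 1 by lra.
pose eta := dl / (2 * (K + 1)).
have eta_gt0 : 0 < eta by rewrite divr_gt0 // mulr_gt0.
have etaK : 2 * eta * K / dl <= 1.
  have -> : 2 * eta * K / dl = K / (K + 1).
    by rewrite /eta; field; rewrite ?(gt_eqF dl_gt0) ?(gt_eqF K1_gt0).
  by rewrite ler_pdivrMr // mul1r; lra.
have [z1 fz1] : exists z, f z <= eta.
  (* The minimum with 1 ensures [psi z ^+ 2 <= psi z <= eta]. *)
  have [z hz] := psi_left (Num.min 1 eta) ltac:(by rewrite lt_min ltr01).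
  exists z; rewrite /f; move: hz; rewrite le_min => /andP[h1 h2].
  have := psi_ge0 z; nra.
have [z2 fz2] : exists z, L - eta <= f z.
  by have [_ [z _ <-] /ltW h] := sup_adherent eta_gt0 f_sup; exists z.
pose N := (Num.truncn ((`|v - z1| + `|z2 - v + K|) / dl)).+1.
have N_gt : `|v - z1| + `|z2 - v + K| < N%:R * dl.
  by rewrite -ltr_pdivrMr // truncnS_gt.
have N1 : v - N%:R * dl <= z1.
  have := ler_norm (v - z1); have := normr_ge0 (z2 - v + K); lra.
have N2 : z2 <= v + N%:R * dl - K.
  have := normr_ge0 (v - z1); have := ler_norm (z2 - v + K); lra.
(* The first [N] points bring the left end below [z1], the middle [M] points start at [v], and the
   last [N] keep the right end above [z2] even after a shift by [- K]. *)
pose n := (N + (M + N))%N; pose x0 := v - N%:R * dl.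
have f_left : f x0 <= eta by apply: le_trans fz1; exact: f_nd.
have f_right : L - eta <= f (x0 + n%:R * dl - K).
  apply: le_trans fz2 _; apply: f_nd; apply: le_trans N2 _.
  rewrite /x0 /n !natrD; have := mulr_ge0 (ltW M_gt0) (ltW dl_gt0); lra.
pose F t := \sum_(k < n) f (x0 + k%:R * dl + t).
have F_up t : F t - \sum_(k < n) f (x0 + k%:R * dl) <=
    (L / dl) * Num.max t (- K) + (L + 1).
  have := sum_grid_shift_le f_nd f_ge0 f_le dl_gt0 K_ge0 (ltW eta_gt0) f_left f_right t.
  rewrite -/(F t); lra.
have mF : measurable_fun setT (fun w => F (xi w)).
  apply: measurableT_comp => //; apply: nondecreasing_measurable => // s t st.
  by apply: ler_sum => k _; apply: f_nd; rewrite lerD2l.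
have if_ x : P.-integrable setT (EFin \o (fun w => f (x + xi w))).
  apply: (@bounded_integrable _ _ _ _ _ L).
    apply: measurableT_comp; first exact: nondecreasing_measurable.
    exact: measurable_funD.
  by move=> w; rewrite ger0_norm.
have iF : P.-integrable setT (EFin \o (fun w => F (xi w))).
  apply: (@bounded_integrable _ _ _ _ _ (\sum_(k < n) L)) => // w.
  by rewrite ger0_norm ?sumr_ge0 // ler_sum.
pose q x := (psi x - psi (x - a)) ^+ 2.
have EF_ge : \sum_(k < n) (f (x0 + k%:R * dl) + q (x0 + k%:R * dl) * p) <=
    \int[P]_w F (xi w).
  rewrite Rintegral_sum; last by move=> k; exact: if_.
  apply: ler_sum => k _.
  by apply: (subharmonic_sqr (c := c)) => //; exact: ltW.
have i1 : P.-integrable setT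
    (EFin \o (fun w => L / dl * Num.max (xi w) (- K))).
  exact: (integrableZl measurableT (L / dl) iK).
have icst r : P.-integrable setT (EFin \o (fun w : T => r)).
  exact: finite_measure_integrable_cst.
have i2 : P.-integrable setT
    (EFin \o (fun w => L / dl * Num.max (xi w) (- K) + (L + 1))).
  exact: (integrableD measurableT i1 (icst _)).
set S := \sum_(k < n) f (x0 + k%:R * dl) in F_up.
have EF_le : \int[P]_w F (xi w) <=
    \int[P]_w (L / dl * Num.max (xi w) (- K) + (L + 1) + S).
  apply: le_Rintegral => //; first exact: (integrableD measurableT i2 (icst _)).
  by move=> w _; rewrite -lerBlDr.
rewrite RintegralD // RintegralD // RintegralZl // !Rintegral_probability_cst in EF_le.
have {}EF_le : \int[P]_w F (xi w) <= 2 * L + 1 + S.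
  apply: le_trans EF_le _; rewrite lerD2r.
  have : L / dl * \int[P]_w Num.max (xi w) (- K) <= L / dl * dl.
    by rewrite ler_wpM2l // divr_ge0 // ltW.
  rewrite divfK ?gt_eqF //; lra.
have q_ge0 x : 0 <= q x * p by rewrite mulr_ge0 ?sqr_ge0 // ltW.
have q_big (i : nat) : (i < M)%N -> e ^+ 2 * p <= q (v + i%:R * dl) * p.
  move=> iM; rewrite ler_pM2r //.
  have i0 : 0 <= i%:R * dl by rewrite mulr_ge0 // ltW.
  have ib : i%:R * dl <= b.
    by rewrite -Mdl ler_pM2r // ler_nat ltnW.
  have h1 : psi v <= psi (v + i%:R * dl) by apply: psi_nd; lra.
  have h2 : psi (v + i%:R * dl - a) <= psi (v - b) by apply: psi_nd; lra.
  by rewrite lerXn2r ?nnegrE //; lra.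
have : M%:R * (p * e ^+ 2) <= \sum_(k < n) q (x0 + k%:R * dl) * p.
  (* Only the middle block is kept; the two outer blocks are nonnegative. *)
  rewrite big_split_ord big_split_ord /=.
  apply: (@le_trans _ _ (\sum_(i < M) q (x0 + (N + i)%:R * dl) * p)).
    rewrite mulr_natl -[X in _ *+ X](card_ord M) -sumr_const.
    apply: ler_sum => i _; rewrite mulrC.
    have -> : x0 + (N + i)%:R * dl = v + i%:R * dl by rewrite /x0 natrD; ring.
    exact: q_big.
  rewrite addrCA lerDl addr_ge0 //; apply: sumr_ge0 => i _; exact: q_ge0.
rewrite big_split /= -/S in EF_ge; lra.
Qed.

(** * Consequences of a nonpositive, possibly infinite, mean *)

(** In [\bar R] the difference [+oo - +oo] is [-oo], so the sign of ['E_P[X]] alone does not exclude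
    two infinite parts; [expectation_defined] does. *)
Lemma funeposneg_expectation_le0 (R : realType) (d : measure_display)
    (T : measurableType d) (P : probability T R) (X : T -> R) :
  expectation_defined P X -> ('E_P[X] <= 0)%E ->
  (\int[P]_w (EFin \o X)^\+ w < +oo)%E /\
  (\int[P]_w (EFin \o X)^\+ w <= \int[P]_w (EFin \o X)^\- w)%E.
Proof.
rewrite unlock /expectation_defined (integralE P setT (fun w => (X w)%:E)) => Xdef.
rewrite -/(EFin \o X).
have : (0 <= \int[P]_w (EFin \o X)^\+ w)%E by exact: integral_ge0.
have : (0 <= \int[P]_w (EFin \o X)^\- w)%E by exact: integral_ge0.
move: Xdef.
case: (\int[P]_w (EFin \o X)^\+ w)%E => [p| |] //;
  case: (\int[P]_w (EFin \o X)^\- w)%E => [q| |] //=.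
- by rewrite !lee_fin subr_le0 ltry.
- by move=> *; rewrite ltry leey.
- by move=> [].
Qed.

(** [max (X, -n)] is the positive part minus [min (X^-, n)]. By monotone convergence the means of
    the latter increase to that of [X^-], finite or not, which is at least the finite mean [p] of
    the positive part; hence some [n] exceeds [p - e]. *)
Lemma truncated_mean_le (R : realType) (d : measure_display)
    (T : measurableType d) (P : probability T R) (X : T -> R)
    (mX : measurable_fun setT X)
    (X_def : expectation_defined P X) (X_le0 : ('E_P[X] <= 0)%E)
    (e : R) (e_gt0 : 0 < e) :
  exists2 K : R, 0 <= K &
    P.-integrable setT (EFin \o (fun w => Num.max (X w) (- K))) /\
    \int[P]_w Num.max (X w) (- K) <= e.
Proof.
have [pos_fin pos_le_neg] := funeposneg_expectation_le0 X_def X_le0.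
set p := (\int[P]_w (EFin \o X)^\+ w)%E in pos_fin pos_le_neg.
have p_ge0 : (0 <= p)%E by exact: integral_ge0.
have p_fin : p \is a fin_num by rewrite ge0_fin_numE.
pose g (n : nat) w : \bar R := (Num.min (Num.max (- X w) 0) n%:R)%:E.
have mXneg : measurable_fun setT (fun w => Num.max (- X w) 0).
  by apply: measurable_maxr => //; exact: measurableT_comp.
have mg_ n : measurable_fun setT (fun w => Num.min (Num.max (- X w) 0) n%:R).
  exact: measurable_minr.
have mg n : measurable_fun setT (g n) by exact/measurable_EFinP.
have g0 n w : setT w -> (0 <= g n w)%E.
  by move=> _; rewrite lee_fin le_min le_max lexx orbT /=.
have nd_g w : setT w -> nondecreasing_seq (g^~ w).
  move=> _ m n mn; rewrite lee_fin le_min ge_min lexx /=.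
  by rewrite ge_min ler_nat mn orbT.
have lim_g w : limn (g^~ w) = ((EFin \o X)^\- w)%E.
  apply: lim_near_cst => //; near=> n.
  rewrite /g min_l; first by rewrite funenegE /= -EFin_max.
  by near: n; exact: nbhs_infty_ger.
have mcv := @monotone_convergence _ T R P setT measurableT g mg g0 nd_g.
have [n hn] : exists n, (p - e%:E < \int[P]_w g n w)%E.
  apply: contrapT => nog.
  have ub n : (\int[P]_w g n w <= p - e%:E)%E.
    by rewrite leNgt; apply/negP => h; apply: nog; exists n.
  have : (p <= p - e%:E)%E.
    apply: (le_trans pos_le_neg).
    under eq_integral do rewrite -lim_g.
    rewrite mcv; apply: lime_le; last exact: nearW.
    apply: ereal_nondecreasing_is_cvgn => m n mn.
    by apply: ge0_le_integral => // w _; [exact: g0|exact: nd_g].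
  rewrite -(fineK p_fin) -EFinB lee_fin; lra.
exists n%:R => //.
have maxE w : Num.max (X w) (- n%:R) =
    Num.max (X w) 0 - Num.min (Num.max (- X w) 0) n%:R.
  have [X0|/ltW X0] := leP 0 (X w).
    have nX : - n%:R <= X w by apply: le_trans X0; rewrite oppr_le0.
    by rewrite (max_l nX) max_r ?oppr_le0 // min_l // subr0.
  by rewrite [Num.max (- X w) 0]max_l ?oppr_ge0 // sub0r oppr_min opprK.
have mXpos : measurable_fun setT (fun w => Num.max (X w) 0).
  exact: measurable_maxr.
have ipos : P.-integrable setT (EFin \o (fun w => Num.max (X w) 0)).
  apply/integrableP; split; first exact/measurable_EFinP.
  apply: le_lt_trans pos_fin; rewrite le_eqVlt; apply/orP; left; apply/eqP.
  apply: eq_integral => w _ /=; rewrite ger0_norm ?le_max ?lexx ?orbT //.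
  by rewrite funeposE /= -EFin_max.
have ig : P.-integrable setT
    (EFin \o (fun w => Num.min (Num.max (- X w) 0) n%:R)).
  apply: (@bounded_integrable _ _ _ _ _ n%:R) => // w.
  rewrite ger0_norm ?ge_min ?lexx ?orbT //.
  by rewrite le_min le_max lexx orbT /=.
have -> : (fun w => Num.max (X w) (- n%:R)) =
    (fun w => Num.max (X w) 0 - Num.min (Num.max (- X w) 0) n%:R).
  exact/funext.
split; first exact: (integrableB measurableT ipos ig).
rewrite RintegralB // lerBlDr -lerBlDl.
have Ep : \int[P]_w Num.max (X w) 0 = fine p.
  by congr fine; apply: eq_integral => w _; rewrite funeposE /= -EFin_max.
rewrite Ep -lee_fin EFinB (fineK p_fin) fineK; first exact: ltW.
exact: (integrable_fin_num measurableT ig).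
Unshelve. all: by end_near. Qed.

(** Otherwise [X < 0], a countable union of events [X <= - n.+1%:R^-1], is negligible. The negative
    part then has mean 0, hence so has the positive part, and [X] vanishes almost everywhere. *)
Lemma prob_le_neg_gt0 (R : realType) (d : measure_display)
    (T : measurableType d) (P : probability T R) (X : T -> R)
    (mX : measurable_fun setT X)
    (X_def : expectation_defined P X) (X_le0 : ('E_P[X] <= 0)%E)
    (X_neq0 : ~ P.-negligible [set w | X w != 0]) :
  exists2 a : R, 0 < a & 0 < fine (P [set w | X w <= - a]).
Proof.
have [pos_fin pos_le_neg] := funeposneg_expectation_le0 X_def X_le0.
apply: contrapT => noa; apply: X_neq0.
have mle a : measurable [set w | X w <= a].
  have := mX measurableT _ (measurable_itv `]-oo, a]).
  by rewrite setTI; congr measurable; apply/seteqP; split => w /=; rewrite in_itv.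
have neg0 : P.-negligible (\bigcup_n [set w | X w <= - n.+1%:R^-1]).
  apply: negligible_bigcup => n; apply/negligibleP => //.
  apply/eqP; rewrite eq_le measure_ge0 andbT leNgt; apply/negP => Pgt0.
  apply: noa; exists n.+1%:R^-1; first by rewrite invr_gt0.
  by rewrite fine_gt0 // Pgt0 -ge0_fin_numE // fin_num_measure.
have neg_ae : ae_eq P setT (EFin \o X)^\-%E (cst 0%E).
  apply: negligibleS neg0 => w /= hw.
  have Xw : X w < 0.
    rewrite ltNge; apply/negP => Xw; apply: hw => _.
    by rewrite funenegE /= -EFin_max max_r // oppr_le0.
  exists (Num.truncn (- X w)^-1) => //=.
  rewrite lerNr invf_ple ?posrE ?oppr_gt0 //; exact: ltW (truncnS_gt _).
have mneg : measurable_fun setT (EFin \o X)^\-%E.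
  by apply: measurable_funeneg; exact/measurable_EFinP.
have mpos : measurable_fun setT (EFin \o X)^\+%E.
  by apply: measurable_funepos; exact/measurable_EFinP.
have neg_int : (\int[P]_w (EFin \o X)^\- w = 0)%E.
  rewrite (ae_eq_integral (cst 0%E)) // ?integral0 //.
have pos_int : (\int[P]_w `|(EFin \o X)^\+ w| = 0)%E.
  under eq_integral do rewrite gee0_abs //.
  by apply/eqP; rewrite eq_le -{1}neg_int pos_le_neg integral_ge0.
have /(ae_eq_integral_abs P measurableT mpos) pos_ae := pos_int.
apply: negligibleS (negligibleU neg_ae pos_ae) => w /= Xw.
apply: contrapT => /not_orP[/contrapT hn /contrapT hp]; move/negP: Xw; apply.
move: (hn I) (hp I); rewrite funenegE funeposE /= -!EFin_max => -[hn'] [hp'].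
rewrite eq_le; have : - X w <= 0 by rewrite -hn' le_max lexx.
by rewrite oppr_le0 => ->; rewrite andbT -hp' le_max lexx.
Qed.

(** * Modulus of continuity of a bounded function *)

Definition modulus (R : realType) (y : R -> R) (r : R) : R :=
  sup [set s | exists x z, `|x - z| <= r /\ s = `|y x - y z|].

(** The real [sup] defaults to 0 when [has_sup] fails, so bounds on [modulus] rest on this fact. *)
Lemma modulus_has_sup (R : realType) (y : R -> R) (M r : R) :
  (forall x, `|y x| <= M) -> 0 <= r ->
  has_sup [set s | exists x z, `|x - z| <= r /\ s = `|y x - y z|].
Proof.
move=> yM r0; split; first by exists `|y 0 - y 0|, 0, 0; rewrite subrr normr0.
exists (M + M) => _ [x [z [_ ->]]].
by apply: le_trans (ler_normB _ _) _; exact: lerD.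
Qed.

Lemma le_modulus (R : realType) (y : R -> R) (M r x z : R) :
  (forall t, `|y t| <= M) -> `|x - z| <= r -> `|y x - y z| <= modulus y r.
Proof.
move=> yM xz; apply: ub_le_sup; last by exists x, z.
by have [] := modulus_has_sup yM (le_trans (normr_ge0 _) xz).
Qed.

Lemma modulus_le (R : realType) (y : R -> R) (M r e : R) :
  (forall t, `|y t| <= M) -> 0 <= r ->
  (forall x z, `|x - z| <= r -> `|y x - y z| <= e) -> modulus y r <= e.
Proof.
move=> yM r0 ye; apply: ge_sup; first exact: (modulus_has_sup yM r0).1.
by move=> _ [x [z [xz ->]]]; exact: ye.
Qed.

(** * From the functional equation to constancy *)

Unset Implicit Arguments.
Set Strict Implicit.

Theorem theorem3p1 (R : realType) (d : measure_display) (T : measurableType d)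
    (P : probability T R) (alpha beta : {RV P >-> R}) (y : R -> R)
    (halpha0 : P [set w | alpha w != 0] = 1%E)
    (halpha1 : (0 < P [set w | (`|alpha w| != 1)%R])%E)
    (hln_def : expectation_defined P (fun w => ln `|alpha w|))
    (hln_le0 : ('E_P[fun w => (ln `|alpha w|)%R] <= 0)%E)
    (hy_bounded : bounded_fun y)
    (hy_unif : unif_continuous y)
    (hy : forall x : R,
        (y x)%:E = 'E_P[fun w => y (alpha w * (x - beta w))%R]%E) :
  exists c : R, forall x : R, y x = c.
Proof.
have [M M_gt0 yM'] := ex_strict_bound_gt0 hy_bounded.
have yM t : `|y t| <= M by apply/ltW/yM'.
have y_unif e : 0 < e -> exists2 r : R, 0 < r &
    forall x z, `|x - z| < r -> `|y x - y z| < e.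
  move=> e0; have [r r0 hr] := (unif_continuousP y).1 hy_unif e e0.
  by exists r => // x z xz; exact: (hr (x, z)).
have my : measurable_fun setT y.
  apply: continuous_measurable_fun => x; apply/cvgrPdist_lt => e e0.
  have [r r0 hr] := y_unif e e0; near=> z; apply: hr.
  by near: z; apply: (@cvgr_dist_lt _ _ _ _ _ id x).
pose xi w := ln `|alpha w|.
have malpha : measurable_fun setT alpha by [].
have mbeta : measurable_fun setT beta by [].
have mxi : measurable_fun setT xi.
  apply: (measurableT_comp (@measurable_ln R)).
  exact: measurableT_comp.
pose psi u := modulus y (expR u).
have psi_nd : {homo psi : s t / s <= t}.
  move=> s t st; apply: (modulus_le yM (expR_ge0 _)) => x z xz.
  by apply: (le_modulus yM); apply: le_trans xz _; rewrite ler_expR.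
have psi_ge0 t : 0 <= psi t.
  apply: le_trans (le_modulus (x := 0) (z := 0) yM _); first exact: normr_ge0.
  by rewrite subrr normr0 expR_ge0.
have psi_le t : psi t <= M + M.
  apply: (modulus_le yM (expR_ge0 _)) => x z _.
  by apply: le_trans (ler_normB _ _) _; exact: lerD.
have psi_left e : 0 < e -> exists z, psi z <= e.
  (* Halving [r] turns the non-strict inequality in [modulus] into the strict one of [y_unif]. *)
  move=> e0; have [r r0 hr] := y_unif e e0; exists (ln (r / 2)).
  have r2 : 0 < r / 2 by rewrite divr_gt0.
  rewrite /psi lnK ?posrE //; apply: (modulus_le yM (ltW r2)) => x z xz.
  by apply/ltW/hr; apply: le_lt_trans xz _; lra.
have iy x : P.-integrable setT (EFin \o (fun w => y (alpha w * (x - beta w)))).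
  apply: (@bounded_integrable _ _ _ _ _ M) => //.
  apply: measurableT_comp => //; apply: measurable_funM => //.
  exact: measurable_funB.
have yE x : y x = \int[P]_w y (alpha w * (x - beta w)).
  by have := hy x; rewrite unlock /Rintegral => <-.
(* The two arguments of [y] differ by [alpha w * (x - z)]: [beta] cancels, and the distance is at
   most [expR (u + xi w)]. *)
have psi_sub u : psi u <= \int[P]_w psi (u + xi w).
  apply: (modulus_le yM (expR_ge0 _)) => x z xz.
  rewrite (yE x) (yE z) -RintegralB //.
  have iB : P.-integrable setT (EFin \o (fun w =>
      y (alpha w * (x - beta w)) - y (alpha w * (z - beta w)))).
    exact: (integrableB measurableT (iy x) (iy z)).
  apply: le_trans (le_normr_Rintegral measurableT iB) _.
  apply: le_Rintegral => //.
  - exact: integrable_norm.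
  - apply: (@bounded_integrable _ _ _ _ _ (M + M)).
      apply: measurableT_comp; first exact: nondecreasing_measurable.
      exact: measurable_funD.
    by move=> w; rewrite ger0_norm.
  - move=> w _; apply: (le_modulus yM).
    rewrite -mulrBr opprB addrA subrK normrM mulrC.
    (* Where [alpha w = 0], [ln] takes a default value, but the two arguments coincide and the bound
       holds trivially. *)
    have [->|a0] := eqVneq (alpha w) 0.
      by rewrite normr0 mulr0 expR_ge0.
    by rewrite expRD lnK ?posrE ?normr_gt0 // ler_pM.
have xi_neq0 : ~ P.-negligible [set w | xi w != 0].
  move=> xi0.
  have m0 (a : R) (f : T -> R) : measurable_fun setT f ->
      measurable [set w | f w != a].
    move=> mf; have -> : [set w | f w != a] = ~` (f @^-1` [set a]).
      by apply/seteqP; split => w /= /eqP.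
    by apply: measurableC; rewrite -[X in measurable X]setTI; exact: mf.
  have a0 : P.-negligible [set w | alpha w == 0].
    have -> : [set w | alpha w == 0] = ~` [set w | alpha w != 0].
      by apply/seteqP; split => w /=; [move=> ->|move/negP; rewrite negbK].
    have ma := m0 0 alpha malpha.
    apply/negligibleP; first exact: measurableC.
    by rewrite [LHS](probability_setC P ma) halpha0 subee.
  (* Off the null event [alpha w = 0], [xi w = 0] means exactly [|alpha w| = 1]. *)
  have : P.-negligible [set w | `|alpha w| != 1].
    apply: negligibleS (negligibleU xi0 a0) => w /= a1.
    have [a00|a00] := eqVneq (alpha w) 0; first by right.
    by left; rewrite /xi ln_eq0 ?normr_gt0.
  move/negligibleP => P0; move: halpha1; rewrite P0 ?ltxx //.
  by apply: m0; exact: measurableT_comp.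
have [a a_gt0 Pa] := prob_le_neg_gt0 mxi hln_def hln_le0 xi_neq0.
have psi0 u : psi u = 0.
  apply: (monotone_subharmonic_eq0 mxi psi_nd psi_ge0 psi_le psi_left psi_sub
    a_gt0 Pa) => e e0.
  exact: truncated_mean_le mxi hln_def hln_le0 e e0.
exists (y 0) => x; apply/eqP; rewrite -subr_eq0 -normr_le0.
have [->|x0] := eqVneq x 0; first by rewrite subrr normr0.
rewrite -[leRHS](psi0 (ln `|x|)); apply: (le_modulus yM).
by rewrite subr0 lnK // posrE normr_gt0.
Unshelve. all: by end_near. Qed.
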